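(* Let $X$ be a cosmic space. Then $C_p(X)$ is an Ascoli space if and only if $C_p(X)$ is $\kappa$-Fréchet–Urysohn.
   Context: A regular ($T_1$) space is cosmic if it is a continuous image of a separable metrizable space. For a Tychonoff space $Y$, $C_p(Y)$ and $C_k(Y)$ denote the set $C(Y)$ of all continuous real-valued functions on $Y$ with the topology of pointwise convergence and the compact-open topology, respectively. A Tychonoff space $Y$ is called Ascoli if every compact subset $\mathcal K$ of $C_k(Y)$ is evenly continuous, i.e. the evaluation map $Y\times\mathcal K\to\mathbb R$, $(y,f)\mapsto f(y)$, is continuous. A topological space $Y$ is $\kappa$-Fréchet–Urysohn if for every open $U\subseteq Y$ and every $y\in\overline U$ there is a sequence of points of $U$ converging to $y$. *)

(* Defs.v *)
From HB Require Import structures.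
From mathcomp Require Import all_boot all_order all_algebra.
From mathcomp Require Import all_classical all_reals all_analysis.
Import numFieldTopology.Exports.

Set Implicit Arguments.
Unset Strict Implicit.
Unset Printing Implicit Defensive.

Local Open Scope classical_set_scope.
Local Open Scope ring_scope.

Definition separable_space (T : topologicalType) : Prop :=
  exists2 D : set T, countable D & dense D.

Definition tychonoff_space (T : topologicalType) : Prop :=
  completely_regular_space T /\ accessible_space T.

Definition cosmic_space (R : realType) (X : topologicalType) : Prop :=
  [/\ regular_space X, accessible_space X &
      exists (M : metricType R) (f : M -> X),
        [/\ separable_space M, continuous f & range f = [set: X]]].

Definition Cp (R : realType) (Y : topologicalType) : Type :=
  continuousType Y R.
HB.instance Definition _ (R : realType) (Y : topologicalType) :=
  Topological.copy (Cp R Y)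
    (initial_topology (id : continuousType Y R -> {ptws Y -> R})).

Definition Ck (R : realType) (Y : topologicalType) : Type :=
  continuousType Y R.
HB.instance Definition _ (R : realType) (Y : topologicalType) :=
  Topological.copy (Ck R Y)
    (initial_topology (id : continuousType Y R -> {compact-open, Y -> R})).

(* [K] is used both as a subset of [Ck R Y] and as the corresponding subtype,
   which carries the subspace topology of [Ck R Y]. *)
Definition evenly_continuous (R : realType) (Y : topologicalType)
    (K : set (Ck R Y)) : Prop :=
  continuous (fun yf : Y * K => (set_val yf.2 : continuousType Y R) yf.1).

Definition ascoli_space (R : realType) (Y : topologicalType) : Prop :=
  tychonoff_space Y /\
  forall K : set (Ck R Y), compact K -> evenly_continuous K.

Definition kappa_frechet_urysohn (Y : topologicalType) : Prop :=
  forall (U : set Y) (y : Y), open U -> closure U y ->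
    exists2 u : nat -> Y, (forall n, U (u n)) & u @ \oo --> y.

(* Main.v *)
(* Ascoli: if an open U in Cp(X) has g in its closure, choose f_n in U close to
   g on the union of F_0, ..., F_(n-1), where agreeing with f_n on the finite
   set F_n implies belonging to U.  Let E_n be the part of F_n that continuous
   functions separate from the earlier F_m.  The functions
   phi_n(f) = prod_(x in E_n) clamp 0 1 (f x - n) on Cp(X) do not converge to 0
   in the compact-open topology: otherwise {0, phi_0, phi_1, ...} would be
   compact but not evenly continuous at (0, 0), because some f vanishing on a
   given finite set satisfies phi_n(f) = 1.  So some compact, hence pointwise
   bounded, set of functions contains d_k > n_k on E_(n_k) for some n_k >= k.
   Multiplying f_(n_k) - g by the cutoff clamp 0 1 (d_k - n_k + 1) away from its
   small part yields members of U that converge to g.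
   Conversely, if K is compact and oscillates near y0, the kappa-Frechet-Urysohn
   property gives y_n --> y0 and f_n in K with |f_n y_n - f_n y0| bounded below,
   contradicting uniform closeness of f_n to a cluster point on the compact set
   {y0, y_0, y_1, ...}. *)
From HB Require Import structures.
Require Import Defs.
From mathcomp Require Import all_boot all_order all_algebra.
From mathcomp Require Import all_classical all_reals all_analysis.
From mathcomp Require Import lra ring.
Import Order.TTheory GRing.Theory Num.Theory.
Import numFieldTopology.Exports numFieldNormedType.Exports.

Set Implicit Arguments.
Unset Strict Implicit.
Unset Printing Implicit Defensive.

Local Open Scope classical_set_scope.
Local Open Scope ring_scope.

(** * Initial topologies and convergent sequences *)

Lemma cvg_initial (S : choiceType) (T : topologicalType) (f : S -> T)
    (F : set_system S) (s : S) : Filter F ->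
  f @ F --> f s -> F --> (s : initial_topology f).
Proof.
move=> FF cvf A [_ [[B oB <-] Bfs sBA]].
by apply: filterS sBA _; apply: cvf; exact: open_nbhs_nbhs.
Qed.

(** A filter that does not cluster at [l] has a member missing a neighbourhood of [l]. It is then
    carried by finitely many terms of [u], and a finite set is compact. *)
Lemma compact_cvg_seq (T : topologicalType) (u : nat -> T) (l : T) :
  u @ \oo --> l -> compact (l |` range u).
Proof.
move=> ul F PF FK.
have [cl|ncl] := pselect (cluster F l); first by exists l; split => //; left.
have [A [B [FA lB AB]]] : exists A B, [/\ F A, nbhs l B & A `&` B = set0].
  apply: contrapT => H; apply: ncl => A B FA lB; apply/set0P/eqP => AB.
  by apply: H; exists A, B.
have [N _ uB] := ul _ lB.
have Ffin : F (u @` `I_N).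
  apply: filterS (filterI FK FA) => x [[->|[n _ <-]] Ax].
    by have : (A `&` B) l; [split=> //; exact: nbhs_singleton|rewrite AB].
  exists n => //=; rewrite ltnNge; apply/negP => Nn.
  by have : (A `&` B) (u n); [split=> //; exact: uB|rewrite AB].
have : compact (u @` `I_N) by apply: finite_compact; exact: finite_image.
move=> /(_ F PF Ffin)[x [[n _ <-] clx]]; exists (u n); split => //.
by right; exists n.
Qed.

Section function_spaces.
Context {R : realType}.

(** * Convergence and neighbourhoods in [Cp] and [Ck] *)

Lemma cvg_Cp (X : topologicalType) (F : set_system (Cp R X)) (f : Cp R X) :
  Filter F -> (forall x, g x @[g --> F] --> f x) -> F --> f.
Proof.
move=> FF cvF; apply: (@cvg_initial (continuousType X R) {ptws X -> R} id F f).
apply/cvg_sup => x; apply: (@cvg_initial (X -> R) R (fun g => g x)).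
exact: cvF.
Qed.

Lemma eval_Cp_continuous (X : topologicalType) (x : X) :
  continuous (fun g : Cp R X => g x).
Proof.
move=> f.
apply: (@cvg_comp _ _ _ (id : Cp R X -> {ptws X -> R}) (fun g => g x)).
  exact: (@initial_continuous (continuousType X R) {ptws X -> R} id f).
exact: (@proj_continuous X (fun=> R) x).
Qed.

Lemma cvg_Ck (Y : topologicalType) (F : set_system (Ck R Y)) (f : Ck R Y) :
  Filter F ->
  (forall (C : set Y) (e : R), compact C -> 0 < e -> \forall g \near F,
     forall y, C y -> `|(g : Ck R Y) y - f y| < e) ->
  F --> f.
Proof.
move=> FF cvF.
apply: (@cvg_initial (continuousType Y R) {compact-open, Y -> R} id F f).
apply/(@compact_open_fam_compactP Y R); first exact: (@cts_fun Y R f).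
apply/fam_cvgP => C cptC P /uniform_nbhs[E [entE sEP]].
move: entE; rewrite -entourage_ballE => -[e /= e0 seE].
move: (cvF C e cptC e0); apply: filterS => g ge; apply: sEP => y Cy.
by apply: seE => /=; rewrite /ball/= distrC; exact: ge.
Qed.

Lemma nbhs_Ck (Y : topologicalType) (f : Ck R Y) (C : set Y) (e : R) :
  compact C -> 0 < e -> \forall g \near f, forall y, C y ->
    `|(g : Ck R Y) y - f y| < e.
Proof.
move=> cptC e0.
have : {compact-open, ((id : Ck R Y -> (Y -> R)) @ nbhs f) --> f : Y -> R}.
  exact: (@initial_continuous (continuousType Y R) {compact-open, Y -> R} id f).
move/(@compact_open_fam_compactP Y R) => /(_ (@cts_fun Y R f)).
move/fam_cvgP => /(_ C cptC).
move=> /(_ [set h | forall y, C y -> `|h y - f y| < e]); apply.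
apply/uniform_nbhs; exists [set xy | ball xy.1 e xy.2]; split.
  by rewrite -entourage_ballE; exists e.
by move=> h H y Cy; rewrite distrC; exact: H.
Qed.

Lemma Cp_tychonoff (X : topologicalType) : tychonoff_space (Cp R X).
Proof.
split.
  exact: (@uniform_completely_regular R
    (initial_topology (id : continuousType X R -> {ptws X -> R}))).
move=> f g /eqP fg.
have [x fgx] : exists x, f x != g x.
  apply/not_existsP => H; apply: fg; apply/continuousEP => x.
  by apply/eqP; apply: contra_notT (H x).
exists ((fun h : Cp R X => h x) @^-1` ~` [set g x]); split.
- apply: open_comp; first by move=> ? _; exact: eval_Cp_continuous.
  by rewrite openC; exact: accessible_closed_set1 (hausdorff_accessible _) _.
- by rewrite inE /=; exact/eqP.
- by rewrite inE /=; apply.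
Qed.

(** * From the kappa-Fréchet-Urysohn property to even continuity *)

Lemma kappa_frechet_urysohn_even (Y : topologicalType) (K : set (Ck R Y)) :
  kappa_frechet_urysohn Y -> compact K -> evenly_continuous K.
Proof.
move=> kY cptK [y0 f0]; apply/cvgrPdist_lt => e e0.
have ctsE (f : Ck R Y) : continuous (f : continuousType Y R).
  exact: (@cts_fun Y R f).
pose osc (f : Ck R Y) y : R := `|f y - f y0|.
pose osc0 (f : Ck R Y) : R := `|f y0 - (set_val f0 : continuousType Y R) y0|.
pose U := [set y | exists2 f, K f & e / 2 < osc f y].
have oU : open U.
  rewrite (_ : U = \bigcup_(f in K) (osc f @^-1` [set t | e / 2 < t])).
    apply: bigcup_open => f _; apply: open_comp; last exact: open_gt.
    move=> y _; apply: cvg_norm; apply: cvgB; last exact: cvg_cst.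
    exact: ctsE.
  by apply/seteqP; split=> y [f]; exists f.
(* Off the closure of [U], a neighbourhood [N] of [y0] bounds the oscillation of all members of [K]
   by [e / 2] at once, so closeness to [f0] at the single point [y0] is enough. *)
have [clU|] := pselect (closure U y0); last first.
  move=> /existsNP[N /not_implyP[y0N /nonemptyPn NU]].
  have e2 : 0 < e / 2 by apply: divr_gt0.
  have f0W' := nbhs_Ck (set_val f0) (@compact_set1 Y y0) e2.
  have f0W := @initial_continuous K (Ck R Y) set_val f0 _ f0W'.
  exists (N, [set f : K | osc0 (set_val f) < e / 2]).
    split=> //=; move: f0W; apply: (@filterS _ (nbhs f0)) => f; exact.
  move=> [y f] /= [Ny fy0].
  have : osc (set_val f) y <= e / 2.
    rewrite leNgt; apply/negP => fy.
    have : (U `&` N) y.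
      by split => //; exists (set_val f) => //; exact: set_valP.
    by rewrite NU.
  move: fy0; rewrite /osc/osc0 ltr_norml ler_norml ltr_norml.
  by move=> /andP[? ?] /andP[? ?]; lra.
have [y Uy yy0] := kY U y0 oU clU.
have /choice[f fP] : forall n, exists f, K f /\ e / 2 < osc f (y n).
  by move=> n; have [f Kf ?] := Uy n; exists f.
have Kf : (f @ \oo) K by exists 0%N => // n _; have [] := fP n.
have [g [Kg clg]] := cptK _ _ Kf.
(* Three errors of [e / 8] ([f n] against [g] at [y0] and at [y n], and the oscillation of [g]) add
   up to less than [e / 2]. *)
have e8 : 0 < e / 8 by apply: divr_gt0.
have cptS := compact_cvg_seq yy0.
have gW := nbhs_Ck g cptS e8.
have : \forall n \near \oo, osc g (y n) < e / 8.
  have := cvg_comp y g yy0 (@ctsE g y0).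
  move=> /cvgrPdist_lt /(_ _ e8); apply: filterS => n.
  by rewrite distrC.
move=> [N _ gN].
have fN : (f @ \oo) (f @` [set n | (N <= n)%N]).
  by exists N => // n /= Nn; exists n.
have [_ [[n Nn <-] /= hn]] := clg _ _ fN gW.
have := (fP n).2; rewrite ltNge => /negP[].
have /= h0 := hn y0 (or_introl erefl).
have /= h1 := hn (y n) (or_intror (ex_intro2 _ _ n I erefl)).
have h2 := gN n Nn.
move: h0 h1 h2; rewrite /osc.
move: (_ y0) (_ y0) (_ (y n)) (_ (y n)) => a b c d.
rewrite !ltr_norml => /andP[? ?] /andP[? ?] /andP[? ?].
by rewrite ler_norml; lra.
Qed.

(** * Separation of finite sets by continuous functions *)

Definition functionally_distinct (X : topologicalType) (x y : X) : Prop :=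
  exists h : continuousType X R, h x != h y.

Lemma functionally_distinct_peak (X : topologicalType) (x : X) (s : seq X) :
  (forall y, y \in s -> functionally_distinct x y) ->
  exists g : X -> R, [/\ continuous g, forall z, 0 <= g z, g x = 1 &
    forall y, y \in s -> g y = 0].
Proof.
elim: s => [_|y s IH xs].
  by exists (cst 1); split => // z; exact: cvg_cst.
have [|g [gc g0 gx gs]] := IH.
  by move=> z zs; apply: xs; rewrite inE zs orbT.
have [|h hxy] := xs y; first by rewrite inE eqxx.
have d0 : h x - h y != 0 by rewrite subr_eq0.
(* The new factor is 1 at [x] and 0 at [y]; squaring makes it non-negative. *)
exists (fun z => g z * ((h z - h y) / (h x - h y)) ^+ 2); split.
- move=> z; apply: cvgM; first exact: gc.
  apply: (@continuous_comp _ _ _ (fun z => (h z - h y) / (h x - h y))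
    (fun t => t ^+ 2)); last exact: exprn_continuous.
  apply: cvgM; last exact: cvg_cst.
  by apply: cvgB; [exact: (@cts_fun X R h)|exact: cvg_cst].
- by move=> z; rewrite mulr_ge0 ?sqr_ge0.
- by rewrite gx divff// expr1n mulr1.
- move=> z; rewrite inE => /predU1P[->|/gs ->]; last by rewrite mul0r.
  by rewrite subrr mul0r expr0n mulr0.
Qed.

Lemma functionally_distinct_bump (X : topologicalType) (t s : seq X) :
  (forall x y, x \in t -> y \in s -> functionally_distinct x y) ->
  exists g : X -> R, [/\ continuous g, forall x, x \in t -> 1 <= g x &
    forall y, y \in s -> g y = 0].
Proof.
move=> ts.
(* Non-negativity is carried through the induction so that adding a peak never lowers a value that
   is already at least 1. *)
suff [g [gc _ gt gs]] : exists g : X -> R, [/\ continuous g, forall z, 0 <= g z,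
    forall x, x \in t -> 1 <= g x & forall y, y \in s -> g y = 0].
  by exists g.
elim: t ts => [_|x t IH xts].
  by exists (cst 0); split => // z; exact: cvg_cst.
have [|g [gc g0 gt gs]] := IH.
  by move=> z y zt ys; apply: xts => //; rewrite inE zt orbT.
have [|h [hc h0 hx hs]] := @functionally_distinct_peak X x s.
  by move=> y ys; apply: xts => //; rewrite inE eqxx.
exists (fun z => h z + g z); split.
- by move=> z; apply: cvgD; [exact: hc|exact: gc].
- by move=> z; rewrite addr_ge0.
- move=> z; rewrite inE => /predU1P[->|/gt gz]; first by rewrite hx lerDl.
  by rewrite (le_trans gz)// lerDr.
- by move=> y ys; rewrite hs// gs// addr0.
Qed.

Definition clamp (a b t : R) : R := Num.max a (Num.min b t).

Lemma clamp_continuous a b : continuous (clamp a b).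
Proof.
move=> t; apply: continuous_max; first exact: cvg_cst.
by apply: continuous_min; [exact: cvg_cst|exact: cvg_id].
Qed.

Lemma clamp_itv a b t : a <= b -> a <= clamp a b t <= b.
Proof. by move=> ab; rewrite /clamp le_max lexx/= ge_max ab ge_min lexx. Qed.

Lemma clamp_id a b t : a <= t <= b -> clamp a b t = t.
Proof. by case/andP=> a_t tb; rewrite /clamp (min_idPr tb) (max_idPr a_t). Qed.

Lemma clamp_le a b t : t <= a -> a <= b -> clamp a b t = a.
Proof.
by move=> ta ab; apply/max_idPl; rewrite ge_min ta orbT.
Qed.

Lemma clamp_ge a b t : b <= t -> a <= b -> clamp a b t = b.
Proof. by move=> tb ab; rewrite /clamp (min_idPl tb) (max_idPr ab). Qed.

(** If [a] cannot be separated from some [y] in [E m], then for [n > m] a function separating a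
    point of [E n] from [y] also separates it from [a]. So each [a] in [s] excludes only finitely
    many indices. *)
Lemma near_functionally_distinct (X : topologicalType) (E : nat -> seq X)
    (s : seq X) :
  (forall m n x y, (m < n)%N -> x \in E n -> y \in E m ->
    functionally_distinct x y) ->
  \forall n \near \oo, forall x y, x \in E n -> y \in s ->
    functionally_distinct x y.
Proof.
move=> dE; elim: s => [|a s IH]; first by near=> n.
have : \forall n \near \oo, forall x, x \in E n -> functionally_distinct x a.
  have [[m [y [yE ya]]]|H] := pselect (exists m y,
    y \in E m /\ ~ functionally_distinct y a); last first.
    near=> n => x xE; apply: contrapT => xa; by apply: H; exists n, x.
  exists m.+1 => // n /= mn x xE; have [h hxy] := dE m n x y mn xE yE.
  exists h; apply: contra_not_neq ya => hxa; exists h.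
  by rewrite -hxa eq_sym.
apply: filterS2 IH => n Hs Ha x y xE.
rewrite inE => /predU1P[->|ys]; last exact: Hs.
exact: Ha.
Unshelve. all: by end_near. Qed.

(** * Finite-set neighbourhoods and test functions on [Cp R X] *)

(** The sets of functions that agree with [f] on a finite list generate a filter converging
    pointwise to [f], so each neighbourhood contains one of them. *)
Lemma nbhs_Cp_agree (X : topologicalType) (U : set (Cp R X)) (f : Cp R X) :
  nbhs f U -> exists s : seq X, forall g : Cp R X,
    (forall x, x \in s -> g x = f x) -> U g.
Proof.
move=> fU.
pose B (s : seq X) := [set g : Cp R X | forall x, x \in s -> g x = f x].
have FF : ProperFilter (filter_from setT B).
  apply: filter_from_proper; last by move=> s _; exists f.
  apply: filter_from_filter; first by exists [::].
  move=> s t _ _; exists (s ++ t) => // g Bg; split=> x xs; apply: Bg;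
    by rewrite mem_cat xs ?orbT.
have : filter_from setT B --> f.
  apply: cvg_Cp => x A /= /nbhs_singleton Afx.
  by exists [:: x] => // g Bg /=; rewrite Bg// inE.
by move=> /(_ _ fU)[s _ sBU]; exists s.
Qed.

Lemma nbhs_Cp_seq (X : topologicalType) (f : Cp R X) (s : seq X) (e : R) :
  0 < e ->
  \forall g \near f, forall x, x \in s -> `|(g : Cp R X) x - f x| < e.
Proof.
move=> e0; elim: s => [|a s IH]; first exact: filterE.
have /cvgrPdist_lt /(_ _ e0) := @eval_Cp_continuous X a f.
apply: filterS2 IH => g Hs Ha x; rewrite inE => /predU1P[->|xs]; last exact: Hs.
by rewrite distrC.
Qed.

(** A continuous function of [f] squeezed between the indicators of the conditions [a + 1 <= f] on
    [s] and [a < f] on [s]. *)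
Definition indicator_above (X : topologicalType) (s : seq X) (a : R)
    (f : Cp R X) : R :=
  \prod_(x <- s) clamp 0 1 (f x - a).

Lemma indicator_above_continuous (X : topologicalType) (s : seq X) (a : R) :
  continuous (@indicator_above X s a).
Proof.
apply: continuous_big; first by move=> x; exact: mul_continuous.
move=> x _ f.
apply: (@continuous_comp _ _ _ (fun f : Cp R X => f x)
  (fun t => clamp 0 1 (t - a))); first exact: eval_Cp_continuous.
apply: (@continuous_comp _ _ _ (fun t => t - a)); last exact: clamp_continuous.
by apply: cvgB; [exact: cvg_id|exact: cvg_cst].
Qed.

Lemma indicator_above_neq0 (X : topologicalType) (s : seq X) (a : R)
    (f : Cp R X) x :
  indicator_above s a f != 0 -> x \in s -> a < f x.
Proof.
move=> + xs; rewrite ltNge; apply: contraNN => fx.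
rewrite /indicator_above prodf_seq_eq0; apply/hasP; exists x => //=.
by rewrite clamp_le// subr_le0.
Qed.

Lemma indicator_above_eq1 (X : topologicalType) (s : seq X) (a : R)
    (f : Cp R X) :
  (forall x, x \in s -> a + 1 <= f x) -> indicator_above s a f = 1.
Proof.
move=> fs; rewrite /indicator_above big_seq big1// => x /fs fx.
by rewrite clamp_ge// lerBrDl.
Qed.

(** * Compact sets and cutoffs obtained from even continuity *)

Lemma ascoli_Cp_compact (X : topologicalType) (E : nat -> seq X) :
  (forall K : set (Ck R (Cp R X)), compact K -> evenly_continuous K) ->
  (forall m n x y, (m < n)%N -> x \in E n -> y \in E m ->
    functionally_distinct x y) ->
  exists (C : set (Cp R X)) (n : nat -> nat) (d : nat -> Cp R X),
    [/\ compact C, forall k, (k <= n k)%N, forall k, C (d k) &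
      forall k x, x \in E (n k) -> (n k)%:R < d k x].
Proof.
move=> ascX dE.
pose phi n : Ck R (Cp R X) := mkcts (@indicator_above_continuous X (E n) n%:R).
pose zero : Ck R (Cp R X) := (cst 0 : continuousType (Cp R X) R).
have [phi0|] := pselect (phi @ \oo --> zero).
  exfalso.
  have cptK := compact_cvg_seq phi0.
  set K := zero |` range phi in cptK.
  have Kz : zero \in K by rewrite inE; left.
  have Kphi n : phi n \in K by rewrite inE; right; exists n.
  pose u n : K := exist _ (phi n) (Kphi n).
  have u0 : u @ \oo --> (exist _ zero Kz : K).
    by apply: (@cvg_initial K (Ck R (Cp R X)) set_val).
  pose g0 : Cp R X := (cst 0 : continuousType X R).
  have /cvgrPdist_lt /(_ _ ltr01) [[A B] /= [A0 B0] AB] :=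
    ascX K cptK (g0, exist _ zero Kz : K).
  have [s sA] := nbhs_Cp_agree A0.
  have [n [Bn nE]] : exists n, B (u n) /\
      forall x y, x \in E n -> y \in s -> functionally_distinct x y.
    near \oo => n; exists n; split; near: n; first exact: u0.
    exact: near_functionally_distinct.
  have [g [gc gE gs]] := functionally_distinct_bump nE.
  (* The factor [n.+1] raises the bump to at least [n + 1] on [E n], where [phi n] takes the value
     1, while vanishing on [s] keeps the function in [A]. *)
  have cg : continuous (fun x => n.+1%:R * g x).
    by move=> x; apply: cvgM; [exact: cvg_cst|exact: gc].
  pose f : Cp R X := mkcts cg.
  have Af : A f by apply: sA => x xs; rewrite /= /mkcts gs// mulr0.
  have /= := AB (f, u n) (conj Af Bn).
  rewrite /phi /= /mkcts indicator_above_eq1.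
    by rewrite sub0r normrN normr1 ltxx.
  move=> x /gE gx; rewrite /f /= /mkcts natr1.
  by rewrite ler_peMr.
move=> nphi.
have [C [e [cptC e0 Ce]]] : exists (C : set (Cp R X)) (e : R),
  [/\ compact C, 0 < e &
    ~ \forall n \near \oo, forall f, C f ->
      `|indicator_above (E n) n%:R f| < e].
  apply: contrapT => H; apply: nphi; apply: cvg_Ck => C e cptC e0.
  apply: contrapT => H2; apply: H; exists C, e; split=> // H3; apply: H2.
  move: H3; apply: filterS => n Hn f Cf /=; rewrite subr0; exact: Hn.
(* Of the lower bound [e] only non-vanishing is kept: it already forces the chosen function above
   [n] on all of [E n]. *)
have /choice[nd ndP] : forall k, exists nd : nat * Cp R X,
    [/\ (k <= nd.1)%N, C nd.2 & indicator_above (E nd.1) nd.1%:R nd.2 != 0].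
  move=> k; apply: contrapT => H; apply: Ce; exists k => // n /= kn f Cf.
  rewrite ltNge; apply/negP => ef; apply: H; exists (n, f); split => //=.
  by rewrite -normr_gt0 (lt_le_trans e0).
exists C, (fun k => (nd k).1), (fun k => (nd k).2); split => //.
- by move=> k; have [] := ndP k.
- by move=> k; have [] := ndP k.
- by move=> k x; have [_ _ /indicator_above_neq0] := ndP k; apply.
Unshelve. all: by end_near. Qed.

Lemma compact_Cp_bounded (X : topologicalType) (C : set (Cp R X)) (x : X) :
  compact C -> exists M : R, forall f, C f -> f x <= M.
Proof.
move=> cptC.
have cptx : compact ((fun f : Cp R X => f x) @` C).
  apply: continuous_compact => //; apply: continuous_subspaceT.
  exact: eval_Cp_continuous.
have [M [_ HM]] := compact_bounded cptx.
(* Boundedness provides every real above [M] as a bound, whence [M + 1]. *)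
exists (M + 1) => f Cf.
apply: (le_trans (ler_norm _)); apply: (HM (M + 1)); first by rewrite ltrDl.
by exists f.
Qed.

Lemma ascoli_Cp_point_finite (X : topologicalType) (E : nat -> seq X) :
  (forall K : set (Ck R (Cp R X)), compact K -> evenly_continuous K) ->
  (forall m n x y, (m < n)%N -> x \in E n -> y \in E m ->
    functionally_distinct x y) ->
  exists (n : nat -> nat) (h : nat -> X -> R),
    [/\ forall k, (k <= n k)%N, forall k, continuous (h k),
      forall k x, x \in E (n k) -> h k x = 1 &
      forall x, \forall k \near \oo, h k x = 0].
Proof.
move=> ascX /(ascoli_Cp_compact ascX)[C [n [d [cptC kn Cd dE]]]].
(* The shift by 1 makes the cutoff equal to 1 wherever [d k] exceeds [n k], and 0 wherever [d k] is
   at most [n k - 1]. The latter holds at a fixed [x] for large [k], since the values [d k x] are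
   bounded above and [n k] tends to infinity. *)
exists n, (fun k x => clamp 0 1 (d k x - (n k)%:R + 1)); split=> //.
- move=> k x; apply: (@continuous_comp _ _ _ (fun x => d k x - (n k)%:R + 1)
    (clamp 0 1)); last exact: clamp_continuous.
  apply: cvgD; last exact: cvg_cst.
  by apply: cvgB; [exact: (@cts_fun X R (d k))|exact: cvg_cst].
- by move=> k x /dE dx; rewrite clamp_ge//; lra.
- move=> x; have [M HM] := compact_Cp_bounded x cptC.
  near=> k; rewrite clamp_le//.
  have := HM _ (Cd k).
  have : (k%:R : R) <= (n k)%:R by rewrite ler_nat.
  have : M + 1 <= k%:R by near: k; exact: nbhs_infty_ger.
  lra.
Unshelve. all: by end_near. Qed.

(** * Sequences in an open set converging to a point of its closure *)

Lemma closure_Cp_seq (X : topologicalType) (U : set (Cp R X)) (g : Cp R X) :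
  open U -> closure U g ->
  exists (f : nat -> Cp R X) (F : nat -> seq X),
    (forall n (h : Cp R X), (forall x, x \in F n -> h x = f n x) -> U h) /\
    (forall m n x, (m < n)%N -> x \in F m ->
      `|f n x - g x| < n.+1%:R^-1).
Proof.
move=> oU clU.
have /choice[pick pickP] : forall np : nat * seq X, exists fF : Cp R X * seq X,
    (forall h : Cp R X, (forall x, x \in fF.2 -> h x = fF.1 x) -> U h) /\
    (forall x, x \in np.2 -> `|fF.1 x - g x| < np.1.+1%:R^-1).
  move=> [n P] /=.
  have n0 : 0 < n.+1%:R^-1 :> R by [].
  have [f [Uf fP]] := clU _ (nbhs_Cp_seq g P n0).
  by have [s sU] := nbhs_Cp_agree (open_nbhs_nbhs (conj oU Uf)); exists (f, s).
(* [P n] lists the points of [F 0], ..., [F (n - 1)], on which the [n]-th function must be close to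
   [g]. *)
pose P := fix P n := if n is m.+1 then P m ++ (pick (m, P m)).2 else [::].
exists (fun n => (pick (n, P n)).1), (fun n => (pick (n, P n)).2); split.
  by move=> n; have [] := pickP (n, P n).
move=> m n x mn xm; have [_] := pickP (n, P n); apply => /=.
elim: n mn => // n IH; rewrite ltnS leq_eqVlt mem_cat => /predU1P[<-|/IH ->//].
by rewrite xm orbT.
Qed.

Lemma ascoli_Cp_kappa_frechet_urysohn (X : topologicalType) :
  (forall K : set (Ck R (Cp R X)), compact K -> evenly_continuous K) ->
  kappa_frechet_urysohn (Cp R X).
Proof.
move=> ascX U g oU /(closure_Cp_seq oU)[f [F [fU fg]]].
pose E n := [seq x <- F n | `[< forall m y, (m < n)%N -> y \in F m ->
  functionally_distinct x y >]].
have dE m n x y :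
    (m < n)%N -> x \in E n -> y \in E m -> functionally_distinct x y.
  move=> mn; rewrite !mem_filter => /andP[/asboolP xE _] /andP[_ yF].
  exact: xE yF.
have [n [h [kn hc hE h0]]] := ascoli_Cp_point_finite ascX dE.
pose w k x : R := f (n k) x - g x.
pose e k : R := (n k).+1%:R^-1.
have e0 k : 0 < e k by rewrite invr_gt0.
(* [v k] equals [f (n k)] where [h k] is 1, and also where [w k] is within [e k] of 0, whatever
   [h k] is. Where [h k] is 0 it stays within [e k] of [g]. *)
pose v k x : R := g x +
  (h k x * w k x + (1 - h k x) * clamp (- e k) (e k) (w k x)).
have wc k : continuous (w k).
  move=> x; apply: cvgB; first exact: (@cts_fun X R (f (n k))).
  exact: (@cts_fun X R g).
have vc k : continuous (v k).
  move=> x; apply: cvgD; first exact: (@cts_fun X R g).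
  apply: cvgD; apply: cvgM.
  - exact: hc.
  - exact: wc.
  - by apply: cvgB; [exact: cvg_cst|exact: hc].
  - apply: (@continuous_comp _ _ _ (w k)); first exact: wc.
    exact: clamp_continuous.
exists (fun k => mkcts (vc k) : Cp R X).
  move=> k; apply: (fU (n k)) => x xF; rewrite /= /mkcts /v.
  have [xE|xE] := boolP (x \in E (n k)).
    by rewrite hE// /w; ring.
  rewrite clamp_id; first by rewrite /w; ring.
  (* A point of [F (n k)] outside [E (n k)] is inseparable from some [y] in an earlier [F m]. All
     functions agree at the two points, so the closeness of [f (n k)] to [g] at [y] passes to [x]
     and the clamp acts as the identity. *)
  move: xE; rewrite mem_filter xF andbT => /asboolPn.
  move=> /existsNP[m /existsNP[y /not_implyP[mn /not_implyP[yF xy]]]].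
  have same (q : Cp R X) : q x = q y.
    by apply/eqP; apply: contra_notT xy => qxy; exists q.
  have := fg m (n k) y mn yF; rewrite /w !same -/(e k) ltr_norml.
  by move=> /andP[/ltW -> /ltW ->].
suff vg x : v k x @[k --> \oo] --> g x.
  by apply: cvg_Cp => x; exact: vg.
apply/cvgrPdist_lt => r r0; near=> k; rewrite /v.
have -> : h k x = 0 by near: k; exact: h0.
rewrite mul0r add0r subr0 mul1r opprD addrA subrr sub0r normrN.
apply: (@le_lt_trans _ _ (e k)).
  by rewrite ler_norml; apply: clamp_itv; rewrite ge0_cp// ltW.
(* It remains to bound [r^-1] by [n k + 1], which follows from [k <= n k] once [k] is at least
   [r^-1]. *)
rewrite /e invf_plt ?posrE//.
apply: (@lt_le_trans _ _ k.+1%:R); last by rewrite ler_nat ltnS.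
by rewrite -natr1 ltr_pwDr//; near: k; exact: nbhs_infty_ger.
Unshelve. all: by end_near. Qed.

End function_spaces.

Theorem corollary1p2 (R : realType) (X : topologicalType)
    (cosmicX : cosmic_space R X) :
  ascoli_space R (Cp R X) <-> kappa_frechet_urysohn (Cp R X).
Proof.
split=> [[_ /ascoli_Cp_kappa_frechet_urysohn//]|kX].
split; first exact: Cp_tychonoff.
by move=> K; exact: kappa_frechet_urysohn_even.
Qed.
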